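(* Let $S$ be a numerical semigroup with multiplicity $m$, and let $E\in\mathcal{I}_0(S)$. Let $f\in\{0,\dots,m-1\}$ be the remainder of $\mathrm{F}(S)$ modulo $m$. Then $E=\mathrm{K}(S)$ if and only if $w_i(E)+w_j(S)=w_f(S)=w_f(E)$ for all $i,j\in\{0,\dots,m-1\}$ with $i+j\equiv f\pmod m$.
   Context: $\mathbb{N}$ denotes the non-negative integers. A numerical semigroup $S$ is a submonoid of $(\mathbb{N},+)$ with finite complement in $\mathbb{N}$. The multiplicity $m$ of $S$ is its smallest positive element. The Frobenius number $\mathrm{F}(S)$ is the largest integer not in $S$. The standard canonical ideal of $S$ is $\mathrm{K}(S)=\{x\in\mathbb{Z}:\mathrm{F}(S)-x\notin S\}$. $\mathcal{I}_0(S)=\{E\subseteq\mathbb{N}: E+S\subseteq E,\ \min(E)=0\}$ is the set of ideals of $S$ with minimum $0$. For $E\in\mathcal{I}_0(S)$ (in particular for $E=S$) and $i\in\{0,\dots,m-1\}$, $w_i(E)$ denotes the least element of $E$ congruent to $i$ modulo $m$. *)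

(* Defs.v *)
From mathcomp Require Import all_boot all_order all_algebra.
From mathcomp Require Import all_classical.

Set Implicit Arguments.
Unset Strict Implicit.
Unset Printing Implicit Defensive.

Local Open Scope classical_set_scope.

Definition is_min d (T : porderType d) (A : set T) (x : T) : Prop :=
  A x /\ lbound A x.

Definition is_max d (T : porderType d) (A : set T) (x : T) : Prop :=
  A x /\ ubound A x.

Record numerical_semigroup (S : set nat) : Prop := NumericalSemigroup {
  ns_0 : S 0;
  ns_add : forall x y, S x -> S y -> S (x + y);
  ns_cofinite : finite_set (~` S) }.

(* [xget] returns the default value 0 when the minimum (resp. maximum) does not
   exist; for a numerical semigroup it always exists. *)
Definition multiplicity (S : set nat) : nat :=
  xget 0 (is_min [set x | S x /\ 0 < x]).

(* The complement is taken in the integers, so that F(nat) = -1. *)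
Definition frobenius (S : set nat) : int :=
  xget (0 : int)%R (is_max (~` (Posz @` S))).

Definition canonical_ideal (S : set nat) : set int :=
  [set x : int | ~ (Posz @` S) (frobenius S - x)%R].

(* Membership in I_0(S). *)
Record ideal0 (S E : set nat) : Prop := Ideal0 {
  ideal0_add : [set x + y | x in E & y in S] `<=` E;
  ideal0_min : is_min E 0 }.

(* w_i(E), for residues modulo m; the default 0 of [xget] is never reached when
   m is the multiplicity of S, E is in I_0(S) and i < m. *)
Definition apery (m : nat) (E : set nat) (i : nat) : nat :=
  xget 0 (is_min [set x | E x /\ x = i %[mod m]]).

(* Main.v *)
(* Let W be the least element of S congruent to F(S) modulo m; then F(S) = W - m.
   For a natural number x and a residue j with x + j = F(S) modulo m, the integer
   F(S) - x = W - m - x lies in S iff w_j(S) + m <= W - x, so x lies in K(S) iff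
   W <= x + w_j(S).  As E is stable under adding m, x lies in E iff w_i(E) <= x
   with i = x modulo m; the two descriptions agree iff w_i(E) + w_j(S) = W. *)
Require Import Defs.
From mathcomp Require Import all_boot all_order all_algebra.
From mathcomp Require Import all_classical.
From mathcomp Require Import zify.

Set Implicit Arguments.
Unset Strict Implicit.
Unset Printing Implicit Defensive.

Local Open Scope classical_set_scope.

Lemma eqmod_leq_ex (m a b : nat) :
  a <= b -> a = b %[mod m] -> exists k, b = a + k * m.
Proof.
move=> le_ab /esym/eqP; rewrite eqn_mod_dvd // => /dvdnP[k Dk].
by exists k; rewrite -Dk subnKC.
Qed.

(** Strictness leaves one full [m] to split off, matching the shift by [m] between F(S) and
    w_f(S). *)
Lemma eqmod_ltn_ex (m a b : nat) :
  a < b -> a = b %[mod m] -> exists k, b = a + k * m + m.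
Proof.
move=> lt_ab /(eqmod_leq_ex (ltnW lt_ab))[[|k] Db]; first by lia.
by exists k; rewrite Db mulSn; lia.
Qed.

Lemma eqmod_complement (m f x : nat) : f < m ->
  exists2 j : 'I_m, x + j = f %[mod m] & x %% m + j = f %[mod m].
Proof.
move=> lt_fm; have m_gt0 : 0 < m by lia.
have lt_xm := ltn_pmod x m_gt0.
(* The residue of [f - x], written so as to avoid truncated subtraction. *)
exists (Ordinal (ltn_pmod (f + (m - x %% m)) m_gt0)) => /=; last first.
  by rewrite modnDmr addnCA subnKC ?modnDr // ltnW.
by rewrite -modnDml modnDmr addnCA subnKC ?modnDr // ltnW.
Qed.

Lemma is_min_nat_ex (P : set nat) : P !=set0 -> exists x, is_min P x.
Proof.
move=> [x Px]; have exP : exists x, `[< P x >] by exists x; apply/asboolP.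
case: (ex_minnP exP) => n /asboolP Pn min_n; exists n; split=> // y Py.
by rewrite leEnat; apply/min_n/asboolP.
Qed.

Lemma is_min_xget (P : set nat) : P !=set0 -> is_min P (xget 0 (is_min P)).
Proof. by move=> /is_min_nat_ex; apply: xgetPex. Qed.

Lemma xget_is_min (P : set nat) (x : nat) :
  is_min P x -> xget 0 (is_min P) = x.
Proof.
move=> minx; apply: xget_unique => // y minyP.
have [Py lby] := minyP; have [Px lbx] := minx.
by have := lbx y Py; have := lby x Px; rewrite !leEnat; lia.
Qed.

Section Apery.

Variables (m : nat) (E : set nat).
Hypotheses (E_add : forall x, E x -> E (x + m)).
Hypotheses (E_cofinite : exists N, forall x, N <= x -> E x).

Let E_addM k x : E x -> E (x + k * m).
Proof.
by elim: k => [|k IHk] Ex; rewrite ?addn0 // mulSnr addnA; apply/E_add/IHk.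
Qed.

Lemma aperyP i : 0 < m ->
  is_min [set x | E x /\ x = i %[mod m]] (apery m E i).
Proof.
move=> m_gt0; apply: is_min_xget; have [N EN] := E_cofinite.
(* As [m] is positive, this element of the class of [i] is at least [N]. *)
exists (N * m + i); split; last by rewrite modnMDl.
by apply: EN; rewrite -addnC; apply: leq_trans (leq_addl _ _); apply: leq_pmulr.
Qed.

Lemma apery_mem i : 0 < m -> E (apery m E i).
Proof. by move=> /(aperyP i)[[]]. Qed.

Lemma apery_mod i : 0 < m -> apery m E i = i %[mod m].
Proof. by move=> /(aperyP i)[[]]. Qed.

Lemma apery_le i x : 0 < m -> E x -> x = i %[mod m] -> apery m E i <= x.
Proof. by move=> /(aperyP i)[_ lb] Ex xi; have := lb x (conj Ex xi). Qed.

(** Adding multiples of [m] to w_i(E) stays in E and exhausts its class from there on. With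
    [apery_le], membership in E becomes an inequality. *)
Lemma apery_le_mem i x : 0 < m -> x = i %[mod m] -> apery m E i <= x -> E x.
Proof.
move=> m_gt0 xi le_wx.
have [k ->] := eqmod_leq_ex le_wx (etrans (apery_mod i m_gt0) (esym xi)).
exact/E_addM/apery_mem.
Qed.

End Apery.

Section NumericalSemigroup.

Variable S : set nat.
Hypothesis hS : numerical_semigroup S.

Local Notation m := (multiplicity S).
Local Notation F := (frobenius S).

Lemma ns_conductor : exists N, forall x, N <= x -> S x.
Proof.
have [X DX] := finite_fsetP.1 (ns_cofinite hS).
exists (\max_(y <- finmap.enum_fset X) y).+1 => x ltx; apply: contrapT => nSx.
have : (~` S) x by [].
rewrite DX /= => xX.
have := @leq_bigmax_seq _ (finmap.enum_fset X) xpredT id x xX isT.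
by rewrite leqNgt ltx.
Qed.

Lemma multiplicityP : is_min [set x | S x /\ 0 < x] m.
Proof.
apply: is_min_xget; have [N SN] := ns_conductor.
by exists N.+1; split=> //; apply: SN.
Qed.

Lemma multiplicity_mem : S m. Proof. by case: multiplicityP => -[]. Qed.

Lemma multiplicity_gt0 : 0 < m. Proof. by case: multiplicityP => -[]. Qed.

Lemma ns_addm x : S x -> S (x + m).
Proof. by move=> Sx; apply/(ns_add hS Sx)/multiplicity_mem. Qed.

Lemma frobeniusP : is_max (~` (Posz @` S)) F.
Proof.
apply: xgetPex; have [N SN] := ns_conductor.
(* The shift by one puts the gap -1 at index 0. *)
pose P n := `[< ~ (Posz @` S) (n%:Z - 1)%R >].
have exP : exists n, P n by exists 0; apply/asboolP => -[s _]; lia.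
have ubP n : P n -> n <= N.
  move=> /asboolP nS; rewrite leqNgt; apply/negP => lt_Nn; apply: nS.
  by exists n.-1; [apply: SN|]; lia.
case: (ex_maxnP exP ubP) => n /asboolP Pn max_n.
exists (n%:Z - 1)%R; split=> // x nSx.
(* Integers below -1 have no index, but [n - 1] is at least -1 and bounds them. *)
have [x_lt|x_ge] := Order.TotalTheory.ltP x (-1)%R; first by lia.
have Dx : x = ((absz (x + 1))%:Z - 1)%R by lia.
have : P (absz (x + 1)%R) by apply/asboolP; rewrite -Dx.
by move=> /max_n; lia.
Qed.

Lemma frobenius_notin s : S s -> Posz s <> F.
Proof. by move=> Ss Ds; case: frobeniusP => nSF _; apply: nSF; exists s. Qed.

Lemma gt_frobenius_mem s : (F < Posz s)%R -> S s.
Proof.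
move=> ltFs; apply: contrapT => nSs; case: frobeniusP => _ /(_ (Posz s)) ub.
suff : (Posz s <= F)%R by lia.
by apply: ub => -[t St [Dt]]; apply: nSs; rewrite -Dt.
Qed.

Lemma frobenius_geN1 : (-1 <= F)%R.
Proof. by case: frobeniusP => _; apply => -[s _]; lia. Qed.

(** For negative [x], F(S) - x exceeds F(S) and so lies in S. *)
Lemma canonical_ideal_ge0 (x : int) : canonical_ideal S x -> (0 <= x)%R.
Proof.
move=> Kx; have F_ge := frobenius_geN1; rewrite Order.TotalTheory.leNgt.
apply/negP => x_lt0.
by apply: Kx; exists (absz (F - x)%R); [apply: gt_frobenius_mem|]; lia.
Qed.

Variable f : 'I_m.
Hypothesis hf : Posz f = (F %% Posz m)%Z.

(** F(S) + m lies in S, being above F(S). A smaller element of S in its class would reach F(S)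
    itself by adding multiples of [m]. *)
Lemma frobenius_apery : F = ((apery m S f)%:Z - m%:Z)%R.
Proof.
have m_gt0 := multiplicity_gt0; have F_ge := frobenius_geN1.
pose n := absz (F + m%:Z)%R; have Dn : Posz n = (F + m%:Z)%R by lia.
have nf : n = f %[mod m].
  apply/eqP; rewrite -eqz_nat -!modz_nat Dn modzDr hf modz_mod.
  exact: eqxx.
suff -> : apery m S f = n by lia.
apply: xget_is_min; split; first by split=> //; apply: gt_frobenius_mem; lia.
move=> x [Sx xf]; rewrite leEnat leqNgt; apply/negP => lt_xn.
have [k Dk] := eqmod_ltn_ex lt_xn (etrans xf (esym nf)).
apply: (@frobenius_notin (x + k * m)); last by lia.
elim: k {Dk} => [|k IHk]; first by rewrite addn0.
by rewrite mulSnr addnA; apply: ns_addm.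
Qed.

(** Otherwise w_j(S) - m would exceed F(S), giving an element of S in the class of [j] below its
    minimum. *)
Lemma apery_le_apery_frobenius j : apery m S j <= apery m S f.
Proof.
have m_gt0 := multiplicity_gt0; rewrite leqNgt; apply/negP => lt_fj.
have DF := frobenius_apery; have F_ge := frobenius_geN1.
have Sx : S (apery m S j - m) by apply: gt_frobenius_mem; lia.
have := @apery_le m S ns_conductor j _ m_gt0 Sx.
have le_mj : m <= apery m S j by lia.
move=> /(_ _); rewrite -(modnDr (_ - _)) subnK //.
by move=> /(_ (apery_mod ns_conductor j m_gt0)); lia.
Qed.

Lemma canonical_idealE (x j : nat) : x + j = f %[mod m] ->
  canonical_ideal S (Posz x) <-> apery m S f <= x + apery m S j.
Proof.
move=> xjf; have m_gt0 := multiplicity_gt0; have DF := frobenius_apery.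
have wj := apery_mod ns_conductor j m_gt0.
have wf := apery_mod ns_conductor f m_gt0.
split=> [Kx|le_W [s Ss Ds]].
  (* If x + w_j(S) < w_f(S), the difference is [k * m + m], so F(S) - x = w_j(S) + k m lies in S. *)
  rewrite leqNgt; apply/negP => lt_W; apply: Kx.
  have [|k Dk] := @eqmod_ltn_ex m _ _ lt_W.
    by rewrite -modnDmr wj modnDmr xjf wf.
  exists (apery m S j + k * m); last by lia.
  apply: (@apery_le_mem m S ns_addm ns_conductor j) => //; last exact: leq_addr.
  by rewrite addnC modnMDl.
(* Since s = F(S) - x is in the class of [j], w_j(S) is at most [s], against [le_W]. *)
have Dsm : apery m S f = x + s + m by lia.
suff : apery m S j <= s by lia.
apply: apery_le ns_conductor _ _ m_gt0 Ss _.
by apply/eqP; rewrite -(eqn_modDl x) xjf -wf Dsm modnDr.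
Qed.

End NumericalSemigroup.

Theorem proposition4p10 (S E : set nat) (f : 'I_(multiplicity S))
  (hS : numerical_semigroup S) (hE : ideal0 S E)
  (hf : Posz f = (frobenius S %% Posz (multiplicity S))%Z) :
  Posz @` E = canonical_ideal S <->
  (forall i j : 'I_(multiplicity S), i + j = f %[mod multiplicity S] ->
     apery (multiplicity S) E i + apery (multiplicity S) S j
       = apery (multiplicity S) S f
     /\ apery (multiplicity S) S f = apery (multiplicity S) E f).
Proof.
set m := multiplicity S in f hf *.
have m_gt0 : 0 < m := multiplicity_gt0 hS.
have S_cof := ns_conductor hS.
have E_S x s : E x -> S s -> E (x + s).
  by move=> Ex Ss; apply: (ideal0_add hE); exists x => //; exists s.
have E_add x : E x -> E (x + m) by move=> /E_S; apply; apply: multiplicity_mem.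
have [E0 _] := ideal0_min hE.
have E_cof : exists N, forall x, N <= x -> E x.
  by have [N SN] := S_cof; exists N => x /SN Sx; exact: (E_S 0 x E0 Sx).
(* Taking i = f and j = 0 in the sum formula will then give w_f(E) = w_f(S). *)
have w0 : apery m S 0 = 0.
  by apply/eqP; rewrite -leqn0; apply: apery_le => //; apply: ns_0.
split=> [EK|w_eq].
  have memE x : E x <-> canonical_ideal S (Posz x).
    by rewrite -EK; split=> [Ex|[y Ey [<-]]] //; exists x.
  have w_eq (i j : nat) : i + j = f %[mod m] ->
      apery m E i + apery m S j = apery m S f.
    move=> ijf; apply/eqP; rewrite eqn_leq; apply/andP; split; last first.
      (* Lower bound on the sum: w_i(E) belongs to E = K(S), so the criterion applies to it. *)
      have wijf : apery m E i + j = f %[mod m].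
        by rewrite -modnDml apery_mod // modnDml.
      by apply/(canonical_idealE hS hf wijf)/memE; apply: apery_mem.
    (* Upper bound: w_f(S) - w_j(S) is in the class of [i] and meets the criterion with equality, so
       it lies in K(S) = E and bounds w_i(E). *)
    have le_jf := apery_le_apery_frobenius hS hf j.
    have y_i : apery m S f - apery m S j = i %[mod m].
      apply/eqP; rewrite -(eqn_modDr (apery m S j)) subnK // apery_mod //.
      by rewrite -(modnDmr i) apery_mod // modnDmr ijf.
    have yjf : apery m S f - apery m S j + j = f %[mod m].
      by rewrite -modnDml y_i modnDml.
    rewrite -(subnK le_jf) leq_add2r; apply: apery_le => //.
    by apply/memE/(canonical_idealE hS hf yjf); rewrite subnK.
  move=> i j ijf; split; first exact: w_eq.
  by rewrite -(w_eq f 0) ?addn0 // w0 addn0.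
have memE (x : nat) : E x <-> canonical_ideal S (Posz x).
  have [j xjf ijf] := eqmod_complement x (ltn_ord f).
  have [wij _] := w_eq (Ordinal (ltn_pmod x m_gt0)) j ijf.
  (* Replacing w_f(S) by w_i(E) + w_j(S) and cancelling w_j(S) turns the criterion for K(S) into
     w_i(E) <= x. *)
  rewrite (canonical_idealE hS hf xjf) -wij leq_add2r /=.
  have x_i : x = x %% m %[mod m] by rewrite modn_mod.
  by split=> [Ex|]; [apply: apery_le|apply: apery_le_mem].
apply/seteqP; split=> [_ [x Ex <-]|x Kx]; first exact/memE.
have Dx : x = Posz (absz x) by have := canonical_ideal_ge0 hS Kx; lia.
by exists (absz x) => //; apply/memE; rewrite -Dx.
Qed.
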